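(* Let $x$ be a complex number (or an indeterminate), and let $(a_{i,j})_{i,j\ge0}$ be the sequence defined by the recurrence $$a_{i,j}=a_{i-1,j}+a_{i,j-1}+x\,a_{i-1,j-1},\qquad i,j\ge1,$$ together with the initial conditions $a_{i,0}=i$ and $a_{0,i}=-i$ for all $i\ge0$. Then for every integer $n\ge1$, $$\det_{0\le i,j\le 2n-1}(a_{i,j})=(1+x)^{2n(n-1)}.$$ *)

(* Defs.v *)
From HB Require Import structures.
From mathcomp Require Export all_boot all_order all_algebra.

Set Implicit Arguments.
Unset Strict Implicit.
Unset Printing Implicit Defensive.

(* Main.v *)
Require Import Defs.
From mathcomp Require Import all_boot all_order all_algebra.
From mathcomp Require Import ring.

Import GRing.Theory.
Local Open Scope ring_scope.

(** With y = 1 + x, the array has the closed form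
      a_(i,j) = sum_k y^k (C(i,k+1) C(j,k) - C(i,k) C(j,k+1)),
    because the recurrence says that the mixed difference in i and j multiplies
    a by y, while it shifts k down by one in each product of binomials.  Hence
    the matrix is L T L^T, where L is the unitriangular Pascal matrix and T the
    skew-symmetric tridiagonal matrix with subdiagonal 1, y, y^2, ..., and
    det T = (y^0 y^2 ... y^(2n-2))^2. *)

Definition skew_tridiag {R : comNzRingType} (b : nat -> R) m : 'M[R]_m :=
  \matrix_(i, j) (b j *+ (i == j.+1 :> nat) - b i *+ (j == i.+1 :> nat)).

Definition pascal_mx (R : comNzRingType) m : 'M[R]_m :=
  \matrix_(i, j) 'C(i, j)%:R.

Lemma det_pascal_mx (R : comNzRingType) m : \det (pascal_mx R m) = 1.
Proof.
rewrite det_trig; last first.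
  by apply/is_trig_mxP => i j ltij; rewrite mxE bin_small.
by rewrite big1 // => i _; rewrite mxE binn.
Qed.

(** Row 0 has the single nonzero entry [- b 0] in column 1; with both deleted, column 0 keeps only
    [b 0]. Two expansions strip a 2x2 block. *)
Lemma det_skew_tridiag_step (R : comNzRingType) (b : nat -> R) m :
  \det (skew_tridiag b m.+2)
    = b 0%N ^+ 2 * \det (skew_tridiag (fun k => b k.+2) m).
Proof.
rewrite (expand_det_row _ ord0) (bigD1 (lift ord0 ord0)) //= big1 ?addr0; last first.
  move=> [[|[|j]] ltj] //= _; by rewrite mxE /= subr0 mul0r.
rewrite /cofactor (expand_det_col _ ord0) (bigD1 ord0) //= big1 ?addr0; last first.
  move=> [[|i] lti] //= _; by rewrite !mxE /= subr0 mul0r.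
rewrite /cofactor !mxE /=.
set A := row' _ _; have -> : A = skew_tridiag (fun k => b k.+2) m.
  by apply/matrixP=> i j; rewrite !mxE.
by rewrite /bump /=; ring.
Qed.

Lemma det_skew_tridiag (R : comNzRingType) (b : nat -> R) n :
  \det (skew_tridiag b n.*2) = (\prod_(k < n) b k.*2) ^+ 2.
Proof.
elim: n b => [|n IHn] b; first by rewrite det_mx00 big_ord0 expr1n.
by rewrite doubleS det_skew_tridiag_step IHn big_ord_recl exprMn.
Qed.

(** The closed form truncated at [k < m], which is exact once [i, j <= m]. *)
Definition binom_form {R : comNzRingType} (y : R) m i j : R :=
  \sum_(k < m) y ^+ k *
    ('C(i, k.+1)%:R * 'C(j, k)%:R - 'C(i, k)%:R * 'C(j, k.+1)%:R).

Lemma binom_form_mixed_diff (R : comNzRingType) (y : R) m i j :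
  binom_form y m.+1 i.+1 j.+1 - binom_form y m.+1 i.+1 j
    - binom_form y m.+1 i j.+1 + binom_form y m.+1 i j = y * binom_form y m i j.
Proof.
rewrite /binom_form -!sumrB -big_split big_ord_recl /= !bin0 !bin1 mulr_sumr.
(* The [k = 0] term is [i - j], whose mixed difference is 0; Pascal's rule shifts the others down by
   one. *)
rewrite -[RHS]add0r; congr (_ + _); first by rewrite -!natr1; ring.
apply: eq_bigr => k _; rewrite /bump /= !add1n !binS !natrD exprS; ring.
Qed.

Lemma binom_form_stable (R : comNzRingType) (y : R) m i j :
  (i <= m)%N -> (j <= m)%N -> binom_form y m.+1 i j = binom_form y m i j.
Proof.
move=> le_im le_jm; rewrite /binom_form big_ord_recr /=.
by rewrite ['C(i, _)]bin_small // ['C(j, m.+1)]bin_small //; ring.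
Qed.

Lemma rec_binom_form (R : comNzRingType) (x : R) (a : nat -> nat -> R) :
  (forall i j, a i.+1 j.+1 = a i j.+1 + a i.+1 j + x * a i j) ->
  (forall i, a i 0%N = i%:R) -> (forall i, a 0%N i = - i%:R) ->
  forall m i j, (i <= m)%N -> (j <= m)%N ->
  a i j = binom_form (1 + x) m i j.
Proof.
move=> a_rec a_col0 a_row0 [|m] i j.
  by rewrite !leqn0 => /eqP-> /eqP->; rewrite a_col0 /binom_form big_ord0.
elim: i j => [|i IHi] j lei.
  move=> _; rewrite a_row0 /binom_form big_ord_recl big1 => [|k _] /=.
    by rewrite !bin0 !bin1; ring.
  by rewrite !bin0n /=; ring.
elim: j => [|j IHj] lej.
  rewrite a_col0 /binom_form big_ord_recl big1 => [|k _] /=.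
    by rewrite !bin0 !bin1; ring.
  by rewrite !bin0n /=; ring.
have diff := binom_form_mixed_diff _ (1 + x) m i j.
rewrite a_rec IHi ?(ltnW lei) // IHj ?(ltnW lej) // IHi ?(ltnW lei) ?(ltnW lej) //.
(* Since [i, j <= m], both sides of [diff] can use the truncation [m.+1]; it then reads as the
   recurrence. *)
rewrite -(binom_form_stable _ _ m i j) // in diff.
symmetry; apply: subr0_eq; rewrite -[RHS](subrr ((1 + x) * binom_form (1 + x) m.+1 i j)).
by rewrite -{1}diff; ring.
Qed.

Lemma pascal_mx_skew_tridiag (R : comNzRingType) (b : nat -> R) m (i j : 'I_m) :
  (pascal_mx R m *m skew_tridiag b m *m (pascal_mx R m)^T) i j
    = \sum_(k < m) b k *
        ('C(i, k.+1)%:R * 'C(j, k)%:R - 'C(i, k)%:R * 'C(j, k.+1)%:R).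
Proof.
(* By skew symmetry only the lower half [S] needs computing; the other half is a transpose. *)
pose S : 'M[R]_m := \matrix_(i, j) (b j *+ (i == j.+1 :> nat)).
have -> : skew_tridiag b m = S - S^T by apply/matrixP=> k l; rewrite !mxE.
have PSPT (p q : 'I_m) : (pascal_mx R m *m S *m (pascal_mx R m)^T) p q
    = \sum_(k < m) b k * ('C(p, k.+1)%:R * 'C(q, k)%:R).
  rewrite mxE; apply: eq_bigr => k _; rewrite !mxE mulrA; congr (_ * _).
  case: (ltnP k.+1 m) => [ltk|gek].
    rewrite (bigD1 (Ordinal ltk)) //= big1 => [|l neq_l].
      by rewrite !mxE eqxx mulr1n addr0 mulrC.
    by rewrite !mxE -[_ == _ :> nat]/(l == Ordinal ltk) (negPf neq_l) mulr0.
  (* The last column of [S] is zero, in accord with ['C(p, m) = 0] for [p < m]. *)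
  rewrite bin_small ?(leq_trans (ltn_ord p)) // mulr0 big1 // => l _.
  by rewrite !mxE ltn_eqF ?mulr0 // (leq_trans (ltn_ord l)).
rewrite mulmxBr mulmxBl [LHS]mxE PSPT mxE.
have -> : pascal_mx R m *m S^T *m (pascal_mx R m)^T
    = (pascal_mx R m *m S *m (pascal_mx R m)^T)^T.
  by rewrite !trmx_mul trmxK mulmxA.
rewrite [X in _ - X]mxE PSPT -sumrB; apply: eq_bigr => k _.
by rewrite mulrBr; congr (_ - _ * _); rewrite mulrC.
Qed.

(* MathComp world. R ranges over all nontrivial commutative rings: the field of
   complex numbers (x a complex number) and polynomial rings such as {poly int}
   or {poly C} (x = 'X an indeterminate) are instances. *)
Theorem theorem3 (R : comNzRingType) (x : R) (a : nat -> nat -> R)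
  (a_rec : forall i j : nat,
     a i.+1 j.+1 = a i j.+1 + a i.+1 j + x * a i j)
  (a_col0 : forall i : nat, a i 0%N = i%:R)
  (a_row0 : forall i : nat, a 0%N i = - i%:R)
  (n : nat) (n_ge1 : (1 <= n)%N) :
  \det (\matrix_(i < (2 * n)%N, j < (2 * n)%N) a i j)
    = (1 + x) ^+ (2 * n * (n - 1))%N.
Proof.
have -> : \matrix_(i < (2 * n)%N, j < (2 * n)%N) a i j
    = pascal_mx R _ *m skew_tridiag (GRing.exp (1 + x)) _ *m (pascal_mx R _)^T.
  apply/matrixP=> i j; rewrite mxE pascal_mx_skew_tridiag.
  by rewrite (rec_binom_form _ _ _ a_rec a_col0 a_row0 _ _ _ (ltnW (ltn_ord i)) (ltnW (ltn_ord j))).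
rewrite !det_mulmx det_tr det_pascal_mx mul1r mulr1 mul2n det_skew_tridiag.
rewrite -(big_morph _ (exprD _) (expr0 _)) -exprM; congr (_ ^+ _).
under eq_bigr do rewrite -mul2n.
(* The sum of all [k < n] is ['C(n, 2)], and [2 * 'C(n, 2) = (n - 1) * n]. *)
rewrite -big_distrr /= -(big_mkord xpredT id) bin2_sum mul_bin_left bin1.
by rewrite mulnC mulnA mulnAC mul2n.
Qed.
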